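(* Let $T\in \mathcal{B}_{A}(\mathcal{H})$ and $\alpha\in[0,1]$. Then $$\|T\|_{A_\alpha}^2 \geq \max \Big\{ \alpha w_{A}^2(T)+(1-\alpha) c_{A}(T^{\sharp_A}T),\ \alpha c_{A}^2(T)+(1-\alpha) \|T\|_{A}^2,\ 2\sqrt{\alpha (1-\alpha)}\,w_{A}(T)\sqrt{c_{A}(T^{\sharp_A}T)},\ 2\sqrt{\alpha (1-\alpha)}\,c_{A}(T)\|T\|_{A} \Big\}.$$
   Context: $\mathcal{H}$ is a complex Hilbert space with inner product $\langle\cdot,\cdot\rangle$, $\mathcal{B}(\mathcal{H})$ is the algebra of bounded linear operators on $\mathcal{H}$, and $A\in\mathcal{B}(\mathcal{H})$ is a fixed positive operator (self-adjoint with $\langle Ax,x\rangle\ge 0$ for all $x\in\mathcal{H}$). Put $\langle x,y\rangle_A=\langle Ax,y\rangle$ and $\|x\|_A=\sqrt{\langle x,x\rangle_A}=\|A^{1/2}x\|$. $R(\cdot)$ denotes range. Let $\mathcal{B}_A(\mathcal{H})=\{T\in\mathcal{B}(\mathcal{H}) : R(T^*A)\subseteq R(A)\}$, a subalgebra of $\mathcal{B}(\mathcal{H})$ whose elements $T$ are $A$-bounded (there is $c>0$ with $\|Tx\|_A\le c\|x\|_A$ for all $x\in\mathcal{H}$). For $T\in\mathcal{B}_A(\mathcal{H})$, $T^{\sharp_A}$ denotes the unique solution $X\in\mathcal{B}(\mathcal{H})$ of $AX=T^*A$ with $R(X)\subseteq\overline{R(A)}$; it again belongs to $\mathcal{B}_A(\mathcal{H})$.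 For an $A$-bounded operator $T$: - the $A$-operator semi-norm is $\|T\|_A=\sup\{\|Tx\|_A/\|x\|_A : x\in\overline{R(A)},\ x\ne 0\}$; - the $A$-numerical radius is $w_A(T)=\sup\{|\langle Tx,x\rangle_A| : x\in\mathcal{H},\ \|x\|_A=1\}$; - the $A$-Crawford number is $c_A(T)=\inf\{|\langle Tx,x\rangle_A| : x\in\mathcal{H},\ \|x\|_A=1\}$; - for $\alpha\in[0,1]$, $\|T\|_{A_\alpha}=\sup\left\{\sqrt{\alpha|\langle Tx,x\rangle_A|^2+(1-\alpha)\|Tx\|_A^2} : x\in\mathcal{H},\ \|x\|_A=1\right\}$. *)

(* Defs.v *)
From HB Require Import structures.
From mathcomp Require Import all_boot all_order all_algebra complex.
From mathcomp Require Import all_classical all_reals all_analysis.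

Set Implicit Arguments.
Unset Strict Implicit.
Unset Printing Implicit Defensive.

Import Order.TTheory GRing.Theory Num.Theory.
Import numFieldNormedType.Exports.

Local Open Scope classical_set_scope.
Local Open Scope ring_scope.
Local Open Scope complex_scope.

Section SemiHilbert.
Context {R : realType} {H : completeNormedModType R[i]}.
(* [{dot H for Num.conj}] : linear in the first argument, conjugate-linear in
   the second, Hermitian and positive definite. *)
Variable dot : {dot H for Num.conj}.

(* With [H] complete, this makes [(H, dot)] a complex Hilbert space. *)
Definition norm_from_dot : Prop := forall x : H, dot x x = `|x| ^+ 2.

Definition bounded_operator (T : H -> H) : Prop :=
  linear T /\ exists M : R, forall x, `|T x| <= M%:C * `|x|.

(* The default value of [xget] is never used for a bounded [T] on a Hilbert
   space, where the set is a singleton. *)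
Definition adjoint (T : H -> H) : H -> H :=
  xget (fun=> 0) [set S : H -> H | bounded_operator S /\
                                   forall x y, dot (T x) y = dot x (S y)].

(* In the order of [R[i]], [0 <= z] means that [z] is real and nonnegative. *)
Definition positive_operator (A : H -> H) : Prop :=
  [/\ bounded_operator A, adjoint A = A & forall x, 0 <= dot (A x) x].

Variable A : H -> H.

Definition dotA (x y : H) : R[i] := dot (A x) y.

Definition normA (x : H) : R := Num.sqrt (complex.Re (dotA x x)).

Definition BA : set (H -> H) :=
  [set T | bounded_operator T /\ range (adjoint T \o A) `<=` range A].

(* For [T] in [BA] there is exactly one such [X] (Douglas' theorem), so that
   the default value of [xget] is not used. *)
Definition sharpA (T : H -> H) : H -> H :=
  xget (fun=> 0) [set X : H -> H | [/\ bounded_operator X,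
                                       A \o X = adjoint T \o A &
                                       range X `<=` closure (range A)]].

Definition absA (T : H -> H) (x : H) : R := complex.Re `|dotA (T x) x|.

Definition sphereA : set H := [set x | normA x = 1].

(* [sup] and [inf] are real-valued, with value 0 on the empty set and [sup] = 0
   on unbounded sets.  The sets below are empty only for [A = 0], and bounded
   for every [A]-bounded [T]. *)
Definition opnormA (T : H -> H) : R :=
  sup [set normA (T x) / normA x | x in [set x | closure (range A) x /\ x != 0]].

Definition numradiusA (T : H -> H) : R := sup [set absA T x | x in sphereA].

Definition crawfordA (T : H -> H) : R := inf [set absA T x | x in sphereA].

Definition alphanormA (alpha : R) (T : H -> H) : R :=
  sup [set Num.sqrt (alpha * absA T x ^+ 2 + (1 - alpha) * normA (T x) ^+ 2)
      | x in sphereA].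

End SemiHilbert.

(* Main.v *)
Require Import Defs.
From HB Require Import structures.
From mathcomp Require Import all_boot all_order all_algebra complex.
From mathcomp Require Import all_classical all_reals all_analysis.
From mathcomp Require Import ring lra.

Set Implicit Arguments.
Unset Strict Implicit.
Unset Printing Implicit Defensive.

Import Order.TTheory GRing.Theory Num.Theory.
Import numFieldNormedType.Exports.

Local Open Scope classical_set_scope.
Local Open Scope ring_scope.
Local Open Scope complex_scope.

(* Pointwise on the A-unit sphere, [c_A (T)] and [c_A (T^# T)] bound
   [|<T x, x>_A|] and [|T x|_A ^ 2 = |<T^# T x, x>_A|] from below, which gives the
   first two terms of the maximum; the last two follow by AM-GM.  The real content
   is that the supremum defining [|T|_(A_alpha)] is finite, i.e. that [T] is
   A-bounded.  From [R(T^* A) <= R(A)] the vectors [A T x] with [|A x| <= 1] are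
   weakly bounded, so [|A T x| <= C * |A x|] by uniform boundedness.  Choosing [Y]
   with [A Y = T^* A T] makes [Y] symmetric for [<., .>_A] with
   [|A Y x| <= D * |A x|], and log-convexity of [|Y^k x|_A] upgrades this to
   [|T x|_A ^ 2 = <x, Y x>_A <= D * |x|_A ^ 2]. *)

(** * Linear functions and elementary real inequalities *)

Section LinearFunction.
Context {K : pzRingType} {U V : lmodType K} (f : U -> V) (f_lin : linear f).

Lemma linear_fun0 : f 0 = 0.
Proof. by have := f_lin (-1) 0 0; rewrite scaler0 addr0 scaleN1r addNr. Qed.

Lemma linear_funZ a x : f (a *: x) = a *: f x.
Proof. by rewrite -[a *: x]addr0 f_lin linear_fun0 addr0. Qed.

Lemma linear_funD x y : f (x + y) = f x + f y.
Proof. by have := f_lin 1 x y; rewrite !scale1r. Qed.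

End LinearFunction.

Lemma discriminant_le (R : realFieldType) (a b c : R) :
  0 <= a -> (forall t, 0 <= a * t ^+ 2 + 2 * b * t + c) -> b ^+ 2 <= a * c.
Proof.
rewrite le_eqVlt => /orP[/eqP <- | a_gt0] h.
  have [->|b_neq0] := eqVneq b 0; first by rewrite expr0n mul0r.
  (* At this point the affine function [2 * b * t + c] takes the value [-1], which contradicts
     nonnegativity. *)
  have := h (- (c + 1) / (2 * b)).
  have -> : 0 * (- (c + 1) / (2 * b)) ^+ 2 + 2 * b * (- (c + 1) / (2 * b)) + c
    = -1 by field.
  lra.
have := h (- b / a).
have -> : a * (- b / a) ^+ 2 + 2 * b * (- b / a) + c = (a * c - b ^+ 2) / a.
  by field; lra.
by rewrite pmulr_lge0 ?invr_gt0// subr_ge0.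
Qed.

Lemma bernoulli_le (R : realDomainType) (s : R) (n : nat) :
  0 <= s -> 1 + n%:R * s <= (1 + s) ^+ n.
Proof.
move=> s_ge0; elim: n => [|n ih]; first by rewrite mul0r addr0 expr0.
have n_ge0 : 0 <= n%:R :> R by [].
rewrite exprS -natr1.
apply: (le_trans _ (ler_wpM2l _ ih)); nra.
Qed.

Lemma exists_nat_gt (R : realType) (x : R) : exists n : nat, x < n%:R.
Proof.
by exists (Num.bound `|x|); rewrite (le_lt_trans (ler_norm _))// archi_boundP.
Qed.

Lemma exists_geometric_lt (R : realType) (C e : R) :
  0 < e -> exists n : nat, C * 3^-1 ^+ n < e.
Proof.
move=> e_gt0; have [n n_gt] := exists_nat_gt (C / e); exists n.
rewrite exprVn ltr_pdivrMr ?exprn_gt0// -ltr_pdivrMl// mulrC.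
apply: (lt_le_trans n_gt).
have := @bernoulli_le R 2 n; have -> : 1 + 2 = 3 :> R by ring.
have : 0 <= n%:R :> R by [].
lra.
Qed.

(** * Positive semidefinite forms and symmetric maps of controlled growth *)

Section RealForm.
Context {R : realType} {V : lmodType R[i]}.

(* Only real scalars and real values are involved, so that the lemmas below
   apply to the real part of a Hermitian form. *)
Definition psd_form (b : V -> V -> R) : Prop :=
  [/\ forall x y, b x y = b y x,
      forall x y z, b (x + y) z = b x z + b y z,
      forall (t : R) x y, b (t%:C *: x) y = t * b x y
    & forall x, 0 <= b x x].

Variables (b : V -> V -> R) (b_psd : psd_form b).

Lemma psd_form_sqrD x y t :
  b (x + t%:C *: y) (x + t%:C *: y) = b y y * t ^+ 2 + 2 * b x y * t + b x x.
Proof.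
have [bC bD bZ _] := b_psd.
by rewrite bD bZ bC [b y _]bC !bD !bZ (bC y x); ring.
Qed.

Lemma psd_form_cauchy_schwarz x y : b x y ^+ 2 <= b x x * b y y.
Proof.
have [_ _ _ b_ge0] := b_psd.
by rewrite mulrC; apply: discriminant_le => // t; rewrite -psd_form_sqrD.
Qed.

(* Krein-Lax: [a k := b (Y^k x) (Y^k x)] is log-convex by Cauchy-Schwarz, hence
   [a k >= (a 1 / a 0) ^ k * a 0], and the growth hypothesis gives
   [a 1 / a 0 <= D ^ 2]. *)
Lemma symmetric_growth_bound (Y : V -> V) (x : V) (D K : R) :
  (forall y z, b (Y y) z = b y (Y z)) -> 0 < D ->
  (forall n, b x (iter n Y x) <= K * D ^+ n) ->
  b x (Y x) <= D * b x x.
Proof.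
move=> Ysym D_gt0 growth.
have [bC _ _ b_ge0] := b_psd.
pose a k := b (iter k Y x) (iter k Y x).
have a_ge0 k : 0 <= a k by apply: b_ge0.
(* Symmetry moves all iterates to one side, so these values depend only on [m + n]. *)
have shift m n : b (iter m Y x) (iter n Y x) = b x (iter (m + n) Y x).
  elim: m n => //= m ih n; rewrite Ysym -[Y (iter n Y x)]/(iter n.+1 Y x) ih.
  by rewrite addnS.
have a_log_convex k : a k.+1 ^+ 2 <= a k * a k.+2.
  have -> : a k.+1 = b (iter k Y x) (iter k.+2 Y x).
    by rewrite /a !shift addSn !addnS.
  exact: psd_form_cauchy_schwarz.
have a_growth k : a k <= K * (D ^+ 2) ^+ k.
  by rewrite /a shift (le_trans (growth _))// addnn -mul2n exprM.
suff a1_le : a 1%N <= D ^+ 2 * a 0%N.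
  have [b_le0|b_gt0] := ler0P (b x (Y x)).
    by rewrite (le_trans b_le0)// mulr_ge0 ?b_ge0 ?ltW.
  rewrite -ler_sqr ?nnegrE ?mulr_ge0 ?b_ge0 ?(ltW D_gt0) ?(ltW b_gt0)//.
  apply: (le_trans (psd_form_cauchy_schwarz _ _)).
  have -> : (D * b x x) ^+ 2 = b x x * (D ^+ 2 * b x x) by ring.
  by rewrite ler_wpM2l.
rewrite leNgt; apply/negP => a1_gt.
have D2_gt0 : 0 < D ^+ 2 by rewrite exprn_gt0.
have a0_gt0 : 0 < a 0%N.
  rewrite lt0r a_ge0 andbT; apply/eqP => a0.
  have := a_log_convex 0%N; rewrite a0 mul0r => h.
  move: a1_gt; rewrite a0 mulr0 => h1; nra.
(* [1 + s] is the ratio of [a 1 / a 0] to [D ^ 2]. As [s > 0], Bernoulli turns the geometric growth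
   into [(1 + k * s) * a 0 <= K] for every [k], which is absurd. *)
pose s := a 1%N / (a 0%N * D ^+ 2) - 1.
have s_gt0 : 0 < s.
  by rewrite subr_gt0 ltr_pdivlMr ?mulr_gt0// mul1r mulrC.
have a1E : a 1%N = (1 + s) * D ^+ 2 * a 0%N.
  by rewrite /s; field; rewrite !gt_eqF.
have a_step k : 0 < a k /\ (1 + s) * D ^+ 2 * a k <= a k.+1.
  elim: k => [|k [ak_gt0 ih]]; first by rewrite a1E.
  have ak1_gt0 : 0 < a k.+1.
    by apply: lt_le_trans ih; rewrite !mulr_gt0// ltr_wpDl.
  split=> //; rewrite -(ler_pM2l ak_gt0).
  apply: le_trans (a_log_convex k).
  have -> : a k * ((1 + s) * D ^+ 2 * a k.+1) =
    ((1 + s) * D ^+ 2 * a k) * a k.+1 by ring.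
  by rewrite expr2 ler_pM2r.
have a_lower k : ((1 + s) * D ^+ 2) ^+ k * a 0%N <= a k.
  elim: k => [|k ih]; first by rewrite expr0 mul1r.
  apply: le_trans (a_step k).2.
  by rewrite exprS -mulrA ler_pM2l// mulr_gt0// ltr_wpDl.
have lin k : (1 + k%:R * s) * a 0%N <= K.
  have Dk_gt0 : 0 < (D ^+ 2) ^+ k by rewrite exprn_gt0.
  rewrite -(ler_pM2r Dk_gt0); apply: le_trans (a_growth k).
  apply: le_trans (a_lower k); rewrite (exprMn _ (1 + s)).
  rewrite [leRHS]mulrAC ler_pM2r// ler_pM2r//.
  exact/bernoulli_le/ltW.
have sa_gt0 : 0 < s * a 0%N by rewrite mulr_gt0.
have [k] := exists_nat_gt (K / (s * a 0%N)).
rewrite ltr_pdivrMr// => k_gt; have := lin k; apply/negP; rewrite -ltNge.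
apply: lt_le_trans k_gt _.
by rewrite [leRHS]mulrDl mul1r mulrA lerDr.
Qed.

End RealForm.

(** * The real-valued norm and convergence of geometrically controlled sequences *)

Section Hilbert.
Context {R : realType} {H : completeNormedModType R[i]}.

Definition rnorm (x : H) : R := complex.Re `|x|.

Lemma rnormE x : `|x| = (rnorm x)%:C.
Proof. by rewrite RRe_real ?normr_real. Qed.

Lemma rnorm_ge0 x : 0 <= rnorm x.
Proof. by rewrite -ler0c -rnormE. Qed.

Lemma rnormD x y : rnorm (x + y) <= rnorm x + rnorm y.
Proof. by rewrite -lecR rmorphD /= -!rnormE ler_normD. Qed.

Lemma rnormZ (t : R) x : rnorm (t%:C *: x) = `|t| * rnorm x.
Proof.
apply: complexI; rewrite rmorphM /= -!rnormE normrZ; congr (_ * _).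
by rewrite normc_def /= expr0n addr0 sqrtr_sqr.
Qed.

Lemma rnorm_distC x y : rnorm (x - y) = rnorm (y - x).
Proof. by rewrite /rnorm distrC. Qed.

Lemma geometric_cvg (u : nat -> H) :
  (forall n, rnorm (u n.+1 - u n) <= 3^-1 ^+ n) ->
  exists x, forall n, rnorm (x - u n) <= 3 / 2 * 3^-1 ^+ n.
Proof.
move=> u_step.
(* Keeping the subtracted end term of the geometric sum lets the induction on [k] close. *)
have tail n k : rnorm (u (k + n)%N - u n) <= 3 / 2 * (3^-1 ^+ n - 3^-1 ^+ (k + n)).
  elim: k => [|k ih].
    by rewrite add0n !subrr /rnorm normr0 mulr0.
  rewrite addSn -(subrKA (u (k + n)%N)) (le_trans (rnormD _ _))//.
  apply: le_trans (lerD (u_step _) ih) _; rewrite (exprS _ (k + n)).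
  by lra.
have tail_le n m : (n <= m)%N -> rnorm (u m - u n) <= 3 / 2 * 3^-1 ^+ n.
  move=> /subnK <-; apply: le_trans (tail _ _) _.
  have : 0 <= (3^-1 : R) ^+ (m - n + n) by rewrite exprn_ge0.
  by lra.
have /cauchy_exP/cauchy_cvg/cvg_ex[x ux] : cauchy_ex (u n @[n --> \oo]).
  move=> e e_gt0.
  have [n n_lt] : exists n, 3 / 2 * 3^-1 ^+ n < complex.Re e.
    by apply: exists_geometric_lt; move: e_gt0; rewrite ltcE => /andP[].
  exists (u n); exists n => //= m /= nm.
  rewrite -ball_normE /= rnormE.
  move: e_gt0; rewrite !ltcE /= => /andP[/eqP -> _]; rewrite eqxx /=.
  by apply: le_lt_trans n_lt; rewrite rnorm_distC; exact: tail_le.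
exists x => n; apply/ler_addgt0Pr => e e_gt0.
have e_gt0' : 0 < e%:C by rewrite ltcR.
have /ux : nbhs x (ball x e%:C) by exact: nbhsx_ballx.
move=> [N _ /(_ (maxn N n))] /=; rewrite leq_maxl => /(_ isT).
rewrite -ball_normE /= rnormE ltcR => x_lt.
rewrite -(subrKA (u (maxn N n))) (le_trans (rnormD _ _))// addrC.
by rewrite lerD ?(ltW x_lt)// tail_le// leq_maxr.
Qed.

(** * Inner product: uniform boundedness, Riesz representation and adjoints *)

Variables (dot : {dot H for Num.conj}) (dotE : norm_from_dot dot).

Definition rdot (x y : H) : R := complex.Re (dot x y).

Lemma dotC x y : dot x y = (dot y x)^*.
Proof. by rewrite hermC expr0 mul1r. Qed.

Lemma rdotC x y : rdot x y = rdot y x.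
Proof. by rewrite /rdot dotC; case: (dot y x). Qed.

Lemma rdotDl x y z : rdot (x + y) z = rdot x z + rdot y z.
Proof. by rewrite /rdot linearDl raddfD. Qed.

Lemma rdotZl (t : R) x y : rdot (t%:C *: x) y = t * rdot x y.
Proof.
by rewrite /rdot linearZl_LR /=; case: (dot x y) => p q /=; rewrite mul0r subr0.
Qed.

Lemma rdotxx x : rdot x x = rnorm x ^+ 2.
Proof. by rewrite /rdot dotE rnormE -rmorphXn. Qed.

Lemma rdot_psd : psd_form rdot.
Proof.
split; [exact: rdotC | exact: rdotDl | exact: rdotZl | move=> x].
by rewrite rdotxx sqr_ge0.
Qed.

Lemma rdotNl x y : rdot (- x) y = - rdot x y.
Proof. by rewrite /rdot linearNl raddfN. Qed.

Lemma rdotBl x y z : rdot (x - y) z = rdot x z - rdot y z.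
Proof. by rewrite rdotDl rdotNl. Qed.

Lemma rdotBr x y z : rdot z (x - y) = rdot z x - rdot z y.
Proof. by rewrite ![rdot z _]rdotC rdotBl. Qed.

Lemma rdot_norm_le x y : `|rdot x y| <= rnorm x * rnorm y.
Proof.
rewrite -ler_sqr ?nnegrE ?mulr_ge0 ?rnorm_ge0// real_normK ?num_real//.
by rewrite exprMn -!rdotxx psd_form_cauchy_schwarz//; exact: rdot_psd.
Qed.

Lemma rdot_le x y : rdot x y <= rnorm x * rnorm y.
Proof. exact: le_trans (ler_norm _) (rdot_norm_le x y). Qed.

Lemma rnorm_eq0 (x : H) : rnorm x = 0 -> x = 0.
Proof. by move=> x0; apply/normr0_eq0; rewrite rnormE x0. Qed.

(** For [v] nonzero, move [x] by [r] along [v / |v|], with the sign of [rdot x v]: this adds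
    [r * |v|] to the absolute value. *)
Lemma exists_large_rdot (r : R) x v : 0 <= r ->
  exists y, rnorm (y - x) <= r /\ r * rnorm v <= `|rdot y v|.
Proof.
move=> r_ge0; have [v0|v_neq0] := eqVneq (rnorm v) 0.
  by exists x; rewrite v0 subrr mulr0 normr_ge0 /rnorm normr0.
have v_gt0 : 0 < rnorm v by rewrite lt0r v_neq0 rnorm_ge0.
have push (t : R) : `|t| = r -> rnorm (x + (t / rnorm v)%:C *: v - x) <= r /\
    rdot (x + (t / rnorm v)%:C *: v) v = rdot x v + t * rnorm v.
  move=> tr; rewrite addrC addKr rnormZ normrM tr normfV (gtr0_norm v_gt0).
  rewrite divfK// lexx rdotDl rdotZl rdotxx; split=> //.
  by congr (_ + _); field.
have [xv_ge0|xv_lt0] := lerP 0 (rdot x v).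
  have [d_le dE] := push r (ger0_norm r_ge0).
  by eexists; split; [exact: d_le | rewrite dE ler_normr lerDr xv_ge0].
have [d_le dE] := push (- r) (etrans (normrN r) (ger0_norm r_ge0)).
eexists; split; [exact: d_le | rewrite dE ler_normr].
by apply/orP; right; rewrite mulNr opprB lerDl oppr_ge0 ltW.
Qed.

(* Uniform boundedness by a gliding hump instead of Baire's theorem: if [V] is
   unbounded, pick [v n] in [V] of norm at least [n * 3 ^ n] and move [x n] by at
   most [3 ^- n] to make [|<x (n + 1), v n>|] at least [3 ^- n * |v n|]; the later
   moves, of total length at most [3 ^- n / 2], cannot undo this. *)
Lemma weakly_bounded_bounded (V : set H) :
  (forall y, exists M, forall v, V v -> rdot y v <= M) ->
  exists M, forall v, V v -> rnorm v <= M.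
Proof.
move=> weak; apply: contrapT => unbounded.
have /choice[v v_prop] : forall n : nat, exists v, V v /\ n%:R * 3 ^+ n < rnorm v.
  move=> n; apply: contrapT => no_v; apply: unbounded.
  exists (n%:R * 3 ^+ n) => w Vw; rewrite leNgt; apply/negP => w_gt.
  by apply: no_v; exists w.
have /choice[step step_prop] : forall nx : nat * H, exists y,
    rnorm (y - nx.2) <= 3^-1 ^+ nx.1 /\
    3^-1 ^+ nx.1 * rnorm (v nx.1) <= `|rdot y (v nx.1)|.
  by move=> [n x]; apply: exists_large_rdot; rewrite exprn_ge0.
pose u := fix u n := if n is m.+1 then step (m, u m) else 0.
have [|x x_lim] := @geometric_cvg u.
  by move=> n; have [] := step_prop (n, u n).
(* The hump is worth [3 ^- n * |v n|], the later moves take off at most half of it, and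
   [|v n| > n * 3 ^ n]. *)
have large n : n%:R / 2 <= `|rdot x (v n)|.
  have [_ /= hump] := step_prop (n, u n).
  have [_ v_large] := v_prop n.
  have := le_trans (rdot_norm_le (x - u n.+1) (v n))
    (ler_wpM2r (rnorm_ge0 _) (x_lim n.+1)).
  rewrite rdotBl exprS => near_u.
  have := lerB_normD (rdot (u n.+1) (v n)) (rdot x (v n) - rdot (u n.+1) (v n)).
  rewrite [X in _ <= `|X|]addrC subrK => tri.
  have v_scaled : n%:R <= 3^-1 ^+ n * rnorm (v n).
    by rewrite exprVn ler_pdivlMl ?exprn_gt0// mulrC ltW.
  rewrite -[step _]/(u n.+1) in hump.
  lra.
have [M xM] := weak x; have [M' xM'] := weak (- x).
have [n n_gt] := exists_nat_gt (2 * (`|M| + `|M'|)).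
have [Vv _] := v_prop n.
have := large n; rewrite leNgt => /negP; apply.
have := xM _ Vv; have := xM' _ Vv; rewrite rdotNl.
have := ler_norm M; have := ler_norm M'.
have := normr_ge0 M; have := normr_ge0 M'.
by have [] := ler0P (rdot x (v n)); lra.
Qed.

(* Minimize [|x| ^ 2 - 2 * g x]; by the parallelogram identity, a minimizing
   sequence with fast enough decay converges geometrically. *)
Lemma real_riesz (g : H -> R) (M : R) :
  (forall x y, g (x + y) = g x + g y) ->
  (forall (t : R) x, g (t%:C *: x) = t * g x) ->
  (forall x, g x <= M * rnorm x) ->
  exists x, forall y, g y = rdot x y.
Proof.
move=> gD gZ gM.
pose J x := rnorm x ^+ 2 - 2 * g x.
have J_lb x : - M ^+ 2 <= J x.
  have := gM x; have := sqr_ge0 (rnorm x - M); rewrite /J sqrrB; lra.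
pose m := inf (range J).
have m_le x : m <= J x.
  by apply: ge_inf; [exists (- M ^+ 2) => _ [z _ <-] | exists x].
have JD x y t : J (x + t%:C *: y) =
    rnorm y ^+ 2 * t ^+ 2 + 2 * (rdot x y - g y) * t + J x.
  rewrite /J -!rdotxx (psd_form_sqrD rdot_psd) gD gZ; ring.
have /choice[u u_min] : forall n, exists x, J x <= m + (3^-1 ^+ n) ^+ 2 / 4.
  move=> n.
  have [||_ [x _ <-] /ltW Jx] := @inf_adherent R (range J) ((3^-1 ^+ n) ^+ 2 / 4).
  - by rewrite divr_gt0 ?exprn_gt0.
  - by split; [exists (J 0), 0 | exists (- M ^+ 2) => _ [z _ <-]].
  - by exists x.
have u_step n : rnorm (u n.+1 - u n) <= 3^-1 ^+ n.
  rewrite -ler_sqr ?nnegrE ?rnorm_ge0 ?exprn_ge0//.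
  set d := u n.+1 - u n.
  have u1E : u n.+1 = u n + 1%:C *: d by rewrite scale1r addrC subrK.
  have := u_min n; have := u_min n.+1; rewrite u1E JD.
  (* The midpoint of [u n] and [u n.+1] has [J] at least [m], so [|d| ^ 2 / 2] is at most the sum of
     their two excesses over [m], which is below [9 ^- n / 2]. *)
  have := m_le (u n + (2^-1)%:C *: d); rewrite JD.
  have := sqr_ge0 (3^-1 ^+ n : R); rewrite [3^-1 ^+ n.+1]exprS exprMn.
  lra.
have [x x_lim] := geometric_cvg u_step.
exists x => y; apply/eqP; rewrite -subr_eq0 -normr_le0.
apply/ler_addgt0Pr => e e_gt0.
(* In units of [3 ^- n * |y|], near-minimality of [u n] costs [1 / 2] and its distance to [x] costs
   [3 / 2]. *)
have approx n : `|g y - rdot x y| <= 3^-1 ^+ n * (2 * rnorm y).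
  have crit : `|rdot (u n) y - g y| <= 3^-1 ^+ n * rnorm y / 2.
    rewrite -ler_sqr ?nnegrE ?divr_ge0 ?mulr_ge0 ?exprn_ge0 ?rnorm_ge0//.
    rewrite real_normK ?num_real//.
    have -> : (3^-1 ^+ n * rnorm y / 2) ^+ 2 =
        rnorm y ^+ 2 * ((3^-1 ^+ n) ^+ 2 / 4).
      by field.
    (* On the line through [u n] along [y], [J] falls below [J (u n)] by at most [9 ^- n / 4]; this
       bounds the discriminant. *)
    apply: discriminant_le; first exact: sqr_ge0.
    move=> t; have := m_le (u n + t%:C *: y); rewrite JD.
    by move=> /le_trans/(_ (lerD (lexx _) (u_min n))); rewrite addrCA lerDl.
  have := le_trans (rdot_norm_le (x - u n) y) (ler_wpM2r (rnorm_ge0 _) (x_lim n)).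
  rewrite rdotBl => near_u.
  have := ler_distD (rdot (u n) y) (g y) (rdot x y).
  rewrite (distrC (g y) (rdot (u n) y)) (distrC (rdot (u n) y) (rdot x y)) => tri.
  lra.
have [n n_lt] := exists_geometric_lt (2 * rnorm y) e_gt0.
by rewrite add0r (le_trans (approx n))// mulrC ltW.
Qed.

(** [a = 1] compares the real parts, and [a = i] the imaginary parts, since [Re (i z) = - Im z]. *)
Lemma eq_rdot_eq_dot x y x' y' :
  (forall a : R[i], rdot (a *: x) y = rdot (a *: x') y') -> dot x y = dot x' y'.
Proof.
move=> h; have := h 'i%C; have := h 1.
rewrite !scale1r /rdot !linearZl_LR /= ![_ * dot _ _]mulrC !ReiNIm.
by case: (dot x y) => p q; case: (dot x' y') => p' q' /= -> /oppr_inj ->.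
Qed.

Lemma dot_inj x y : (forall z, dot z x = dot z y) -> x = y.
Proof.
move=> h; apply/eqP; rewrite -subr_eq0; apply/eqP/rnorm_eq0.
by apply/eqP; rewrite -sqrf_eq0 -rdotxx rdotBr /rdot !h subrr.

Qed.

Lemma bounded_operatorP (T : H -> H) : bounded_operator T <->
  linear T /\ exists2 M : R, 0 <= M & forall x, rnorm (T x) <= M * rnorm x.
Proof.
split=> [[Tlin [M TM]]|[Tlin [M M_ge0 TM]]]; split=> //.
  exists `|M| => // x; apply: le_trans (ler_wpM2r (rnorm_ge0 x) (ler_norm M)).
  by rewrite -lecR rmorphM /= -!rnormE.
by exists M => x; rewrite !rnormE -rmorphM lecR.
Qed.

Lemma adjoint_exists (T : H -> H) : bounded_operator T ->
  exists S, bounded_operator S /\ forall x y, dot (T x) y = dot x (S y).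
Proof.
move=> /bounded_operatorP[Tlin [M M_ge0 TM]].
have /choice[S S_riesz] : forall y, exists s, forall x, rdot (T x) y = rdot s x.
  move=> y; apply: (@real_riesz (fun x => rdot (T x) y) (M * rnorm y)).
  - by move=> x z; rewrite linear_funD// rdotDl.
  - by move=> t x; rewrite linear_funZ// rdotZl.
  - move=> x; apply: le_trans (rdot_le _ _) _.
    by rewrite mulrAC ler_wpM2r ?rnorm_ge0.
have S_adj x y : dot (T x) y = dot x (S y).
  by apply: eq_rdot_eq_dot => a; rewrite -(linear_funZ Tlin) S_riesz rdotC.
exists S; split=> //; apply/bounded_operatorP; split.
  move=> a x y; apply: dot_inj => z.
  by rewrite -S_adj !linearDr !linearZr_LR /= !S_adj.
exists M => // y; have [->|Sy_neq0] := eqVneq (rnorm (S y)) 0.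
  by rewrite mulr_ge0 ?rnorm_ge0.
have Sy_gt0 : 0 < rnorm (S y) by rewrite lt0r Sy_neq0 rnorm_ge0.
(* [|S y| ^ 2 = Re <T (S y), y> <= M * |S y| * |y|], divided by [|S y|]. *)
rewrite -(ler_pM2l Sy_gt0) -expr2 -rdotxx -S_riesz.
apply: le_trans (rdot_le _ _) _.
by rewrite mulrA [_ * M]mulrC ler_wpM2r ?rnorm_ge0.
Qed.

Lemma adjointP (T : H -> H) : bounded_operator T ->
  bounded_operator (adjoint dot T) /\
  forall x y, dot (T x) y = dot x (adjoint dot T y).
Proof. by move=> /adjoint_exists; exact: xgetPex. Qed.

End Hilbert.

(** * Passage to suprema and the weighted mean inequality *)

Lemma mul_sqr_sup_le (R : realType) (E : set R) (k M : R) :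
  0 <= k -> 0 <= M -> (forall e, E e -> 0 <= e /\ k * e ^+ 2 <= M) ->
  k * sup E ^+ 2 <= M.
Proof.
move=> k_ge0 M_ge0 E_le; have [->|/set0P E_neq0] := eqVneq E set0.
  by rewrite sup0 expr0n mulr0.
(* With [k = 0] the hypothesis does not bound [E]; with [k > 0] the bound is [sqrt (M / k)]. *)
have [->|k_neq0] := eqVneq k 0; first by rewrite mul0r.
have k_gt0 : 0 < k by rewrite lt0r k_neq0.
have E_ub e : E e -> e <= Num.sqrt (M / k).
  move=> Ee; have [e_ge0 ke] := E_le _ Ee.
  rewrite -(ger0_norm e_ge0) -sqrtr_sqr ler_sqrt ?divr_ge0//.
  by rewrite ler_pdivlMr// mulrC.
have sup_le : sup E <= Num.sqrt (M / k) by exact: ge_sup.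
have sup_ge0 : 0 <= sup E.
  have [e Ee] := E_neq0; apply: le_trans (E_le _ Ee).1 _.
  by apply: ub_le_sup => //; exists (Num.sqrt (M / k)).
rewrite mulrC -ler_pdivlMr// -(sqr_sqrtr (divr_ge0 M_ge0 k_ge0)).
by rewrite ler_sqr ?nnegrE ?sqrtr_ge0.
Qed.

(** The difference of the two sides is the square of [sqrt alpha * a - sqrt (1 - alpha) * c]. *)
Lemma mean_inequality (R : realType) (alpha a c : R) :
  0 <= alpha <= 1 ->
  2 * Num.sqrt (alpha * (1 - alpha)) * a * c <=
  alpha * a ^+ 2 + (1 - alpha) * c ^+ 2.
Proof.
move=> /andP[al_ge0 al_le1]; have be_ge0 : 0 <= 1 - alpha by rewrite subr_ge0.
rewrite sqrtrM// -subr_ge0.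
set p := Num.sqrt alpha; set q := Num.sqrt (1 - alpha).
have <- : p ^+ 2 = alpha by rewrite sqr_sqrtr.
have <- : q ^+ 2 = 1 - p ^+ 2 by rewrite !sqr_sqrtr.
have -> : p ^+ 2 * a ^+ 2 + q ^+ 2 * c ^+ 2 - 2 * (p * q) * a * c =
    (p * a - q * c) ^+ 2 by ring.
exact: sqr_ge0.
Qed.

(** * A-boundedness of [T] and lower bounds for the alpha-seminorm *)

Section SemiHilbertBounds.
Context {R : realType} {H : completeNormedModType R[i]}.
Variables (dot : {dot H for Num.conj}) (dotE : norm_from_dot dot).
Variables (A : H -> H) (A_pos : positive_operator dot A).

Definition rdotA (x y : H) : R := rdot dot (A x) y.

Lemma positive_operator_sym x y : dot (A x) y = dot x (A y).
Proof.
have [Ab adjA _] := A_pos.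
by have [_ ->] := adjointP dotE Ab; rewrite adjA.
Qed.

Lemma rdotA_psd : psd_form rdotA.
Proof.
have [[Alin _] _ A_ge0] := A_pos.
split=> [x y|x y z|t x y|x]; rewrite /rdotA.
- by rewrite rdotC /rdot -positive_operator_sym.
- by rewrite linear_funD// rdotDl.
- by rewrite linear_funZ// rdotZl.
- by have := A_ge0 x; rewrite lecE => /andP[].
Qed.

Lemma normA_sqr x : normA dot A x ^+ 2 = rdotA x x.
Proof. by have [_ _ _ ge0] := rdotA_psd; rewrite sqr_sqrtr//; exact: ge0. Qed.

Lemma normA_ge0 x : 0 <= normA dot A x.
Proof. exact: sqrtr_ge0. Qed.

Lemma absA_ge0 (S : H -> H) x : 0 <= absA dot A S x.
Proof. by rewrite -ler0c /absA RRe_real ?normr_real. Qed.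

Lemma crawfordA_le (S : H -> H) x : sphereA dot A x ->
  crawfordA dot A S <= absA dot A S x.
Proof.
move=> x1; apply: ge_inf; last by exists x.
by exists 0 => _ [y _ <-]; exact: absA_ge0.
Qed.

Lemma crawfordA_ge0 (S : H -> H) : 0 <= crawfordA dot A S.
Proof.
rewrite /crawfordA; set E := (X in inf X).
have [->|/set0P E_neq0] := eqVneq E set0; first by rewrite inf0.
by apply: lb_le_inf => // _ [y _ <-]; exact: absA_ge0.
Qed.

(** Cauchy-Schwarz for the real form is applied to [S x] and to [i * S x], which give the real and
    the imaginary part; hence the factor 2, harmless for a finiteness bound. *)
Lemma absA_sqr_le (S : H -> H) x :
  absA dot A S x ^+ 2 <= 2 * (rdotA (S x) (S x) * rdotA x x).
Proof.
have [[Alin _] _ _] := A_pos.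
set z := dotA dot A (S x) x.
have -> : absA dot A S x ^+ 2 = complex.Re z ^+ 2 + complex.Im z ^+ 2.
  by apply: complexI; rewrite add_Re2_Im2 rmorphXn /= /absA RRe_real ?normr_real.
have -> : complex.Im z = - rdotA ('i%C *: S x) x.
  by rewrite /rdotA (linear_funZ Alin) /rdot linearZl_LR /= mulrC ReiNIm opprK.
have iS : rdotA ('i%C *: S x) ('i%C *: S x) = rdotA (S x) (S x).
  rewrite /rdotA (linear_funZ Alin) /rdot linearZl_LR linearZr_LR /= mulrA.
  suff -> : 'i%C * Num.conj 'i%C = 1 :> R[i] by rewrite mul1r.
  by rewrite -normCK normc_def /= expr0n expr1n add0r sqrtr1 expr1n.
rewrite sqrrN mulr_natl mulr2n lerD//.
  exact: (psd_form_cauchy_schwarz rdotA_psd).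
by rewrite -iS; exact: (psd_form_cauchy_schwarz rdotA_psd).
Qed.

Variables (T : H -> H) (T_BA : BA dot A T).

(* With [B] the adjoint of [T], [<y, A T x> = <A x, z>] for any [z] with
   [A z = B A y], so the vectors [A T x] with [|A x| <= 1] are weakly bounded. *)
Lemma BA_range_bound :
  exists2 C : R, 0 <= C & forall x, rnorm (A (T x)) <= C * rnorm (A x).
Proof.
have [[Alin _] _ _] := A_pos.
have [/[dup] Tb [Tlin _] rangeT] := T_BA.
have [_ adjT] := adjointP dotE Tb.
have [|C C_ub] := @weakly_bounded_bounded _ _ _ dotE
    [set v | exists2 x, rnorm (A x) <= 1 & v = A (T x)].
  move=> y.
  have [z _ Az] : range A (adjoint dot T (A y)) by apply: rangeT; exists y.
  exists (rnorm z) => _ [x Ax ->].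
  have -> : rdot dot y (A (T x)) = rdot dot (A x) z.
    rewrite rdotC /rdot positive_operator_sym adjT -Az.
    by rewrite -positive_operator_sym.
  apply: le_trans (rdot_le dotE _ _) _.
  by rewrite ler_piMl ?rnorm_ge0.
exists `|C| => // x; apply/ler_addgt0Pr => e e_gt0.
(* Dividing by [|A x| + d] instead of [|A x|] covers [A x = 0], and this [d] gives
   [|C| * d <= e]. *)
pose d := e / (`|C| + 1).
have C1_gt0 : 0 < `|C| + 1 by rewrite ltr_wpDl.
have d_gt0 : 0 < d by rewrite divr_gt0.
have s_gt0 : 0 < rnorm (A x) + d by rewrite ltr_wpDl ?rnorm_ge0.
pose y := (rnorm (A x) + d)^-1%:C *: x.
have Ay : rnorm (A y) <= 1.
  rewrite (linear_funZ Alin) rnormZ normfV (gtr0_norm s_gt0) ler_pdivrMl// mulr1.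
  by rewrite lerDl ltW.
have := C_ub _ (ex_intro2 _ _ y Ay erefl).
rewrite (linear_funZ Tlin) (linear_funZ Alin) rnormZ normfV (gtr0_norm s_gt0).
rewrite ler_pdivrMl// => /le_trans; apply.
rewrite mulrC; apply: le_trans (ler_wpM2r (ltW s_gt0) (ler_norm C)) _.
rewrite mulrDr lerD2l /d mulrA ler_pdivrMr// mulrC ler_pM2l//.
by rewrite lerDl.
Qed.

Lemma BA_A_bounded :
  exists2 D : R, 0 < D & forall x, rdotA (T x) (T x) <= D * rdotA x x.
Proof.
have [Tb rangeT] := T_BA.
have [/bounded_operatorP[_ [M M_ge0 BM]] adjT] := adjointP dotE Tb.
have [C C_ge0 ATC] := BA_range_bound.
have /choice[z Az] : forall y, exists z, A z = adjoint dot T (A y).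
  by move=> y; have [z _ Az] := rangeT _ (ex_intro2 _ _ y I erefl); exists z.
(* [A Y = T^* A T], so that [<Y y, w>_A = <T y, T w>_A]. *)
pose Y y := z (T y).
have rAY y w : rdotA (Y y) w = rdotA (T y) (T w).
  by rewrite /rdotA Az [LHS]rdotC [RHS]rdotC /rdot adjT.
have [rAC _ _ _] := rdotA_psd.
have Ysym y w : rdotA (Y y) w = rdotA y (Y w).
  by rewrite rAY (rAC y) rAY rAC.
have AY y : rnorm (A (Y y)) <= M * C * rnorm (A y).
  by rewrite Az (le_trans (BM _))// -mulrA ler_wpM2l.
pose D := M * C + 1.
have D_gt0 : 0 < D by rewrite ltr_wpDl ?mulr_ge0.
exists D => // x; rewrite -rAY rAC.
(* [K] comes from [<A Y^n x, x> <= |A Y^n x| * |x|] and [|A Y^n x| <= D ^ n * |A x|]. *)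
apply: (symmetric_growth_bound rdotA_psd (K := rnorm x * rnorm (A x)) Ysym D_gt0).
move=> n; rewrite rAC /rdotA.
apply: le_trans (rdot_le dotE _ _) _.
rewrite mulrC -mulrA ler_wpM2l ?rnorm_ge0//.
elim: n => [|n ih]; first by rewrite expr0 mulr1.
apply: le_trans (AY _) _; rewrite exprS mulrCA.
by apply: ler_pM; rewrite ?mulr_ge0 ?rnorm_ge0// lerDl.
Qed.

(** Since [sup] is 0 on unbounded sets, a bound must come first: [2 * D], from [absA_sqr_le] and
    [BA_A_bounded]. *)
Lemma alphanormA_sqr_ge (alpha : R) x : 0 <= alpha <= 1 -> sphereA dot A x ->
  alpha * absA dot A T x ^+ 2 + (1 - alpha) * normA dot A (T x) ^+ 2
    <= alphanormA dot A alpha T ^+ 2.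
Proof.
move=> /andP[al_ge0 al_le1] x1.
have be_ge0 : 0 <= 1 - alpha by rewrite subr_ge0.
pose q y := alpha * absA dot A T y ^+ 2 + (1 - alpha) * normA dot A (T y) ^+ 2.
have q_ge0 y : 0 <= q y by apply: addr_ge0; apply: mulr_ge0 => //; exact: sqr_ge0.
have [D D_gt0 TD] := BA_A_bounded.
have q_le y : sphereA dot A y -> q y <= 2 * D.
  move=> y1.
  have yy : rdotA y y = 1 by rewrite -normA_sqr y1 expr1n.
  have := TD y; have := absA_sqr_le T y; rewrite yy !mulr1 /q normA_sqr.
  have [_ _ _ ge0] := rdotA_psd; have := ge0 (T y); move: (rdotA _ _) => r.
  move: (absA _ _ _ _ ^+ 2) => s r_ge0 sr rD; nra.
have sup_ge : Num.sqrt (q x) <= alphanormA dot A alpha T.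
  apply: ub_le_sup; last by exists x.
  exists (Num.sqrt (2 * D)) => _ [y y1 <-].
  by rewrite ler_sqrt ?q_le// mulr_ge0// ltW.
rewrite -[leLHS]/(q x) -(sqr_sqrtr (q_ge0 x)) ler_sqr ?nnegrE ?sqrtr_ge0//.
exact: le_trans (sqrtr_ge0 _) sup_ge.
Qed.

(* If no [sharpA] existed, its default value [0] would make the left-hand side
   vanish, so Douglas' theorem is not needed. *)
Lemma crawfordA_sharpA_le x : sphereA dot A x ->
  crawfordA dot A (sharpA dot A T \o T) <= normA dot A (T x) ^+ 2.
Proof.
move=> x1; apply: le_trans (crawfordA_le _ x1) _.
have [[Alin _] _ _] := A_pos.
have [Tb _] := T_BA.
have [_ adjT] := adjointP dotE Tb.
rewrite /absA /dotA /sharpA /comp; case: xgetP => [X _ [_ AX _]|_].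
  have -> : A (X (T x)) = adjoint dot T (A (T x)) by have := congr1 (@^~ (T x)) AX.
  (* [<T^* A T x, x> = <A T x, T x>], which is nonnegative and hence its own modulus. *)
  rewrite dotC -adjT dotC conjcK.
  have [_ _ A_ge0] := A_pos; rewrite ger0_norm ?A_ge0//.
  by rewrite normA_sqr.
by rewrite (linear_fun0 Alin) linear0l normr0 sqr_ge0.
Qed.

Lemma numradiusA_bound (alpha : R) : 0 <= alpha <= 1 ->
  alpha * numradiusA dot A T ^+ 2
    + (1 - alpha) * crawfordA dot A (sharpA dot A T \o T)
    <= alphanormA dot A alpha T ^+ 2.
Proof.
move=> alpha01; have /andP[al_ge0 al_le1] := alpha01.
rewrite -lerBrDr.
have below x : sphereA dot A x -> alpha * absA dot A T x ^+ 2 <=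
    alphanormA dot A alpha T ^+ 2
    - (1 - alpha) * crawfordA dot A (sharpA dot A T \o T).
  move=> x1; rewrite lerBrDr; apply: le_trans (alphanormA_sqr_ge alpha01 x1).
  by rewrite lerD2l ler_wpM2l ?subr_ge0 ?crawfordA_sharpA_le.
apply: mul_sqr_sup_le => //; last first.
  by move=> _ [x x1 <-]; split; [exact: absA_ge0 | exact: below].
(* On an empty sphere the Crawford number is [inf set0 = 0], so the bound is still nonnegative. *)
have [S0|/set0P[x x1]] := eqVneq (sphereA dot A) set0.
  by rewrite /crawfordA S0 image_set0 inf0 mulr0 subr0 sqr_ge0.
by apply: le_trans (below x x1); rewrite mulr_ge0 ?sqr_ge0.
Qed.

Lemma opnormA_bound (alpha : R) : 0 <= alpha <= 1 ->
  alpha * crawfordA dot A T ^+ 2 + (1 - alpha) * opnormA dot A T ^+ 2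
    <= alphanormA dot A alpha T ^+ 2.
Proof.
move=> alpha01; have /andP[al_ge0 al_le1] := alpha01.
have be_ge0 : 0 <= 1 - alpha by rewrite subr_ge0.
rewrite addrC -lerBrDr.
have below x : sphereA dot A x -> (1 - alpha) * normA dot A (T x) ^+ 2 <=
    alphanormA dot A alpha T ^+ 2 - alpha * crawfordA dot A T ^+ 2.
  move=> x1; rewrite lerBrDr addrC; apply: le_trans (alphanormA_sqr_ge alpha01 x1).
  rewrite lerD2r ler_wpM2l// ler_sqr ?nnegrE ?crawfordA_ge0 ?absA_ge0//.
  exact: crawfordA_le.
have M_ge0 : 0 <= alphanormA dot A alpha T ^+ 2 - alpha * crawfordA dot A T ^+ 2.
  have [S0|/set0P[x x1]] := eqVneq (sphereA dot A) set0.
    by rewrite /crawfordA S0 image_set0 inf0 expr0n mulr0 subr0 sqr_ge0.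
  by apply: le_trans (below x x1); rewrite mulr_ge0 ?sqr_ge0.
apply: mul_sqr_sup_le => // _ [x _ <-].
split; first by rewrite divr_ge0 ?normA_ge0.
(* A quotient with zero denominator is 0; otherwise [x] is rescaled to the A-unit sphere. *)
have [->|x_neq0] := eqVneq (normA dot A x) 0.
  by rewrite invr0 mulr0 expr0n mulr0.
have x_gt0 : 0 < normA dot A x by rewrite lt0r x_neq0 normA_ge0.
have [[Tlin _] _] := T_BA.
have normAZ (t : R) y : normA dot A (t%:C *: y) = `|t| * normA dot A y.
  have [rAC _ rAZ _] := rdotA_psd.
  apply/eqP; rewrite -(@eqrXn2 _ 2) ?mulr_ge0 ?normA_ge0// exprMn !normA_sqr.
  by rewrite rAZ rAC rAZ mulrA -expr2 real_normK ?num_real.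
have := below ((normA dot A x)^-1%:C *: x).
rewrite (linear_funZ Tlin) !normAZ normfV gtr0_norm//.
rewrite (mulrC (normA dot A x)^-1); apply.
by rewrite /sphereA /= normAZ normfV gtr0_norm// mulVf.
Qed.

End SemiHilbertBounds.

Theorem theorem2p4 (R : realType) (H : completeNormedModType R[i])
    (dot : {dot H for Num.conj}) (dotE : norm_from_dot dot)
    (A : H -> H) (A_pos : positive_operator dot A)
    (T : H -> H) (T_BA : BA dot A T)
    (alpha : R) (alpha01 : 0 <= alpha <= 1) :
  let w := numradiusA dot A in
  let c := crawfordA dot A in
  let TsT := sharpA dot A T \o T in
  Num.max (alpha * w T ^+ 2 + (1 - alpha) * c TsT)
   (Num.max (alpha * c T ^+ 2 + (1 - alpha) * opnormA dot A T ^+ 2)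
    (Num.max (2 * Num.sqrt (alpha * (1 - alpha)) * w T * Num.sqrt (c TsT))
             (2 * Num.sqrt (alpha * (1 - alpha)) * c T * opnormA dot A T)))
  <= alphanormA dot A alpha T ^+ 2.
Proof.
cbv zeta.
have w_le := numradiusA_bound dotE A_pos T_BA alpha01.
have op_le := opnormA_bound dotE A_pos T_BA alpha01.
rewrite !ge_max w_le op_le /=; apply/andP; split.
  (* AM-GM is applied with [sqrt (c TsT)], whose square is [c TsT] because Crawford numbers are
     nonnegative. *)
  apply: le_trans w_le; apply: le_trans (mean_inequality _ _ alpha01) _.
  by rewrite sqr_sqrtr ?crawfordA_ge0.
exact: le_trans (mean_inequality _ _ alpha01) op_le.
Qed.
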